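(* Let $X = \xi(t,u,v)\,\partial_t + \eta_u(t,u,v)\,\partial_u + \eta_v(t,u,v)\,\partial_v$ be a smooth vector field on $M_3$ with $\partial_t\eta_u = 0$ and $\partial_t\eta_v = 0$. If $X$ generates a symmetry of the autonomous system $$\dot u = \omega_u(u,v),\qquad \dot v = \omega_v(u,v),$$ then the push-forward $f_*X = \eta_u\,\partial_u+\eta_v\,\partial_v$ of $X$ by $f : M_3\to M_2$, $f(t,u,v) = (u,v)$, generates a symmetry of the corresponding phase plane equation $$v' = \frac{dv}{du} = \Omega(u,v),\qquad \Omega(u,v) = \frac{\omega_v(u,v)}{\omega_u(u,v)}.$$
   Context: Let $U\subseteq\mathbb{R}^2$ be open with coordinates $(u,v)$, and let $\omega_u,\omega_v : U\to\mathbb{R}$ be smooth with $\omega_u(u,v)\neq 0$ on $U$ (subscripts on $\omega,\eta,\zeta$ are labels, not derivatives). Put $M_2 = U$, $M_3=\mathbb{R}\times U$ with coordinates $(t,u,v)$, $J_5 = M_3\times\mathbb{R}^2$ with coordinates $(t,u,v,\dot u,\dot v)$, and $J_3 = M_2\times\mathbb{R}$ with coordinates $(u,v,v')$. Let $\Delta\subset J_5$ be the subset where $\dot u=\omega_u(u,v)$ and $\dot v=\omega_v(u,v)$, and $\delta\subset J_3$ the subset where $v'=\Omega(u,v)$. Time domain: the prolongation of $X = \xi\partial_t+\eta_u\partial_u+\eta_v\partial_v$ is $$X^{(1)} = X + \eta_u^{(1)}\partial_{\dot u} + \eta_v^{(1)}\partial_{\dot v},\quad \eta_u^{(1)} = D_t\eta_u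 - \dot u D_t\xi,\quad \eta_v^{(1)} = D_t\eta_v - \dot v D_t\xi,\quad D_t = \partial_t+\dot u\partial_u+\dot v\partial_v .$$ $X$ (with $\partial_t\eta_u=\partial_t\eta_v=0$) generates a symmetry of the system if $$X^{(1)}(\dot u-\omega_u)\big|_\Delta = 0 \quad\text{and}\quad X^{(1)}(\dot v-\omega_v)\big|_\Delta = 0 .$$ Phase plane: the prolongation of $Y = \zeta_u(u,v)\partial_u+\zeta_v(u,v)\partial_v$ is $$Y^{(1)} = Y + \zeta_v^{(1)}\partial_{v'},\quad \zeta_v^{(1)} = D_u\zeta_v - v' D_u\zeta_u,\quad D_u = \partial_u+v'\partial_v .$$ $Y$ generates a symmetry of $v'=\Omega(u,v)$ if $Y^{(1)}(v'-\Omega)\big|_\delta = 0$. *)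

(* Defs.v *)
From HB Require Import structures.
From mathcomp Require Import all_boot all_order all_algebra.
From mathcomp Require Import all_classical all_reals all_analysis.
Set Implicit Arguments.
Unset Strict Implicit.
Unset Printing Implicit Defensive.
Import Order.TTheory GRing.Theory Num.Theory.
Import numFieldNormedType.Exports.
Local Open Scope classical_set_scope.
Local Open Scope ring_scope.

(* Points and tangent vectors are row vectors; functions and fields on an open
   set are total functions, constrained only at the points of that set. *)

Definition rowv {R : realType} {n : nat} (s : seq R) : 'rV[R]_n := \row_i s`_i.

Definition partial {R : realType} {n : nat} (i : 'I_n.+1)
    (g : 'rV[R]_n.+1 -> R) : 'rV[R]_n.+1 -> R :=
  fun p => 'D_(delta_mx 0 i) g p.

(* C^infinity: the partial derivatives of all orders exist and are continuous
   on A; the sequence s lists the differentiation indices. *)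
Definition smooth_on {R : realType} {n : nat} (A : set 'rV[R]_n.+1)
    (g : 'rV[R]_n.+1 -> R) : Prop :=
  forall (s : seq 'I_n.+1) (p : 'rV[R]_n.+1), A p ->
    {for p, continuous (foldr partial g s)} /\
    forall i, derivable (foldr partial g s) p (delta_mx 0 i).

Definition smooth_field {R : realType} {n : nat} (A : set 'rV[R]_n.+1)
    (X : 'rV[R]_n.+1 -> 'rV[R]_n.+1) : Prop :=
  forall i, smooth_on A (fun p => X p 0 i).

Definition field_act {R : realType} {n : nat}
    (X : 'rV[R]_n.+1 -> 'rV[R]_n.+1) (g : 'rV[R]_n.+1 -> R) :
    'rV[R]_n.+1 -> R :=
  fun p => \sum_i X p 0 i * partial i g p.

(* Determines Y on f @` A only. *)
Definition is_pushforward {R : realType} {m n : nat} (A : set 'rV[R]_m.+1)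
    (f : 'rV[R]_m.+1 -> 'rV[R]_n.+1) (X : 'rV[R]_m.+1 -> 'rV[R]_m.+1)
    (Y : 'rV[R]_n.+1 -> 'rV[R]_n.+1) : Prop :=
  forall p, A p -> 'd f p (X p) = Y (f p).

(* Coordinates: M_2 : (u, v);  M_3 : (t, u, v);  J_3 : (u, v, v');
   J_5 : (t, u, v, udot, vdot), numbered from 0 in this order. *)

Definition proj32 {R : realType} (p : 'rV[R]_3) : 'rV[R]_2 :=
  rowv [:: p 0 1; p 0 2].

Definition proj53 {R : realType} (q : 'rV[R]_5) : 'rV[R]_3 :=
  rowv [:: q 0 0; q 0 1; q 0 2].

Definition projJ3 {R : realType} (q : 'rV[R]_3) : 'rV[R]_2 :=
  rowv [:: q 0 0; q 0 1].

Definition M3 {R : realType} (U : set 'rV[R]_2) : set 'rV[R]_3 :=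
  [set p | U (proj32 p)].

Definition Dt {R : realType} (g : 'rV[R]_3 -> R) (q : 'rV[R]_5) : R :=
  partial 0 g (proj53 q) + q 0 3 * partial 1 g (proj53 q)
  + q 0 4 * partial 2 g (proj53 q).

Definition prolong_time {R : realType} (X : 'rV[R]_3 -> 'rV[R]_3)
    (q : 'rV[R]_5) : 'rV[R]_5 :=
  let xi := fun p => X p 0 0 in
  let eta_u := fun p => X p 0 1 in
  let eta_v := fun p => X p 0 2 in
  rowv [:: xi (proj53 q); eta_u (proj53 q); eta_v (proj53 q);
           Dt eta_u q - q 0 3 * Dt xi q;
           Dt eta_v q - q 0 4 * Dt xi q].

Definition Delta {R : realType} (U : set 'rV[R]_2)
    (omega_u omega_v : 'rV[R]_2 -> R) : set 'rV[R]_5 :=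
  [set q | [/\ M3 U (proj53 q), q 0 3 = omega_u (proj32 (proj53 q))
             & q 0 4 = omega_v (proj32 (proj53 q))]].

Definition time_symmetry {R : realType} (U : set 'rV[R]_2)
    (omega_u omega_v : 'rV[R]_2 -> R) (X : 'rV[R]_3 -> 'rV[R]_3) : Prop :=
  forall q, Delta U omega_u omega_v q ->
    field_act (prolong_time X)
      (fun q => q 0 3 - omega_u (proj32 (proj53 q))) q = 0 /\
    field_act (prolong_time X)
      (fun q => q 0 4 - omega_v (proj32 (proj53 q))) q = 0.

Definition Du {R : realType} (g : 'rV[R]_2 -> R) (q : 'rV[R]_3) : R :=
  partial 0 g (projJ3 q) + q 0 2 * partial 1 g (projJ3 q).

Definition prolong_phase {R : realType} (Y : 'rV[R]_2 -> 'rV[R]_2)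
    (q : 'rV[R]_3) : 'rV[R]_3 :=
  let zeta_u := fun p => Y p 0 0 in
  let zeta_v := fun p => Y p 0 1 in
  rowv [:: zeta_u (projJ3 q); zeta_v (projJ3 q);
           Du zeta_v q - q 0 2 * Du zeta_u q].

Definition delta {R : realType} (U : set 'rV[R]_2) (Omega : 'rV[R]_2 -> R) :
    set 'rV[R]_3 :=
  [set q | U (projJ3 q) /\ q 0 2 = Omega (projJ3 q)].

Definition phase_symmetry {R : realType} (U : set 'rV[R]_2)
    (Omega : 'rV[R]_2 -> R) (Y : 'rV[R]_2 -> 'rV[R]_2) : Prop :=
  forall q, delta U Omega q ->
    field_act (prolong_phase Y) (fun q => q 0 2 - Omega (projJ3 q)) q = 0.

(* Main.v *)
Require Import Defs.
From HB Require Import structures.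
From mathcomp Require Import all_boot all_order all_algebra.
From mathcomp Require Import all_classical all_reals all_analysis.
From mathcomp Require Import ring.
Set Implicit Arguments.
Unset Strict Implicit.
Unset Printing Implicit Defensive.
Import Order.TTheory GRing.Theory Num.Theory.
Import numFieldNormedType.Exports.
Local Open Scope classical_set_scope.
Local Open Scope ring_scope.

(** Along the system, d/dt = omega_u d/du turns D_t of a function g(u, v) into
    omega_u * D_u g, so the time-domain conditions read
      E_u := omega_u * D_u eta_u - omega_u * D_t xi - eta(omega_u) = 0,
      E_v := omega_u * D_u eta_v - omega_v * D_t xi - eta(omega_v) = 0,
    where eta = eta_u d/du + eta_v d/dv and D_u is taken at v' = Omega.  In the
    combination E_v - Omega * E_u the reparametrization term D_t xi cancels,
    because omega_v = Omega * omega_u.  By the quotient rule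
    eta(omega_v) - Omega * eta(omega_u) = omega_u * eta(Omega), so what is left
    is omega_u times the phase-plane condition
      D_u eta_v - Omega * D_u eta_u - eta(Omega) = 0.

    The push-forward exists because M_3 is the whole line times U: each time
    line over a point of U lies in M_3, so a function with vanishing time
    derivative is constant along it ([constant_along_time]) and equals its
    value on the slice t = 0.  Hence any push-forward Y is, on U, the
    restriction of (eta_u, eta_v) to that slice, and Y inherits the smoothness
    and the partial derivatives of X.

    All the maps between the spaces are linear and send coordinate directions
    to coordinate directions or to 0.  Composition with such a map therefore
    transforms each partial derivative through the very definition of a
    directional derivative ([derive_comp_affine]), without the chain rule for
    total differentials. *)

(** * Directional derivatives along affine lines *)

(** Both sides are limits of the same difference quotient, so the equality
    holds whether or not the derivative exists. *)
Lemma derive_comp_affine (R : realType) (V V' W : normedModType R)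
    (f : V -> V') (g : V' -> W) (p v : V) (w : V') :
  (forall h : R, f (h *: v + p) = h *: w + f p) ->
  'D_v (g \o f) p = 'D_w g (f p).
Proof.
move=> fE; rewrite /derive.
by under eq_fun do rewrite /= fE.
Qed.

Lemma derivable_comp_affine (R : realType) (V V' W : normedModType R)
    (f : V -> V') (g : V' -> W) (p v : V) (w : V') :
  (forall h : R, f (h *: v + p) = h *: w + f p) ->
  derivable (g \o f) p v = derivable g (f p) w.
Proof.
move=> fE; rewrite /derivable.
by under eq_fun do rewrite /= fE.
Qed.

Lemma eq_along_direction (R : realType) (V : normedModType R) (g : V -> R)
    (p v : V) :
  (forall h : R, is_derive (h *: v + p) v g 0) ->
  forall h : R, g (h *: v + p) = g p.
Proof.
move=> dg h; pose c := fun k : R => k *: v + p.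
rewrite -[p in RHS]add0r -(scale0r v).
apply: (@is_derive_0_is_cst _ (g \o c)) => k.
have cE (l : R) : c (l *: 1 + k) = l *: v + c k.
  by rewrite /c scalerDl -addrA [_%:A]mulr1.
have [gd gE] := dg k; split.
  by rewrite (derivable_comp_affine _ cE).
by rewrite (derive_comp_affine _ cE).
Qed.

Lemma derivable_coord (R : realType) n (j : 'I_n) (p v : 'rV[R]_n) :
  derivable (fun q : 'rV[R]_n => q 0 j) p v /\
  'D_v (fun q : 'rV[R]_n => q 0 j) p = v 0 j.
Proof.
pose f := fun q : 'rV[R]_n => q 0 j.
have fE (h : R) : f (h *: v + p) = h *: v 0 j + f p by rewrite /f !mxE.
rewrite -/f -[f]/(id \o f) (derivable_comp_affine _ fE) (derive_comp_affine _ fE).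
by rewrite derive_id; split => //; exact: derivable_id.
Qed.

Lemma derivable0 (R : realType) (V W : normedModType R) (f : V -> W) p :
  derivable f p 0.
Proof.
suff -> : derivable f p 0 = derivable (cst (f p) : V -> W) p 0 by [].
by rewrite /derivable; under eq_fun do rewrite /= scaler0 add0r.
Qed.

(** * Smoothness and linear maps *)

Lemma partial_comp_linear (R : realType) m n
    (f : {linear 'rV[R]_m.+1 -> 'rV[R]_n.+1}) (g : 'rV[R]_n.+1 -> R) i p :
  partial i (g \o f) p = 'D_(f (delta_mx 0 i)) g (f p).
Proof. by apply: derive_comp_affine => h; rewrite linearP. Qed.

Lemma linear_rV_continuous (R : realType) m n
    (f : {linear 'rV[R]_m -> 'rV[R]_n}) : continuous f.
Proof.
rewrite [f : _ -> _](_ : _ =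
  fun q : 'rV[R]_m => \sum_i q 0 i *: f (delta_mx 0 i)); last first.
  apply/funext => q; rewrite {1}(row_sum_delta q) linear_sum.
  by apply: eq_bigr => i _; rewrite linearZ.
apply: continuous_big => [|i _ p]; first exact: add_continuous.
have pc : (fun q : 'rV[R]_m => q 0 i) @ p --> p 0 i.
  exact: coord_continuous.
exact: cvgZr_tmp pc.
Qed.

Lemma partial_eq_on (R : realType) n (A : set 'rV[R]_n.+1)
    (g g' : 'rV[R]_n.+1 -> R) s : open A ->
  (forall p, A p -> g p = g' p) ->
  forall p, A p -> foldr partial g s p = foldr partial g' s p.
Proof.
move=> Ao gg'; elim: s => //= i s IH p Ap.
by apply: near_eq_derive; near=> q; apply: IH; near: q; exact: open_nbhs_nbhs.
Unshelve. all: by end_near. Qed.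

(** A field is arbitrary off its open set, so this is what lets the smoothness
    of a push-forward be read off from a representative of it. *)
Lemma smooth_on_eq (R : realType) n (A : set 'rV[R]_n.+1)
    (g g' : 'rV[R]_n.+1 -> R) : open A ->
  (forall p, A p -> g p = g' p) -> smooth_on A g -> smooth_on A g'.
Proof.
move=> Ao gg' sg s p Ap; have [gc gd] := sg s p Ap.
have eqn : {near p, foldr partial g s =1 foldr partial g' s}.
  near=> q; apply: partial_eq_on gg' _ _ => //.
  by near: q; exact: open_nbhs_nbhs.
split=> [|i]; last exact: near_eq_derivable (gd i).
have gE := partial_eq_on s Ao gg' Ap.
suff : foldr partial g' s @ p --> foldr partial g s p by rewrite gE.
exact: cvg_trans (near_eq_cvg eqn) gc.
Unshelve. all: by end_near. Qed.

(** Composing with a linear map that takes coordinate directions to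
    coordinate directions only relabels the differentiation indices, which is
    why smoothness in the sense of iterated partial derivatives is preserved
    (a general linear map would produce linear combinations). *)
Lemma foldr_partial_comp_linear (R : realType) m n
    (f : {linear 'rV[R]_m.+1 -> 'rV[R]_n.+1}) (sg : 'I_m.+1 -> 'I_n.+1)
    (g : 'rV[R]_n.+1 -> R) s :
  (forall i, f (delta_mx 0 i) = delta_mx 0 (sg i)) ->
  foldr partial (g \o f) s = foldr partial g (map sg s) \o f.
Proof.
move=> fE; elim: s => //= i s ->; apply/funext => p.
by rewrite partial_comp_linear fE.
Qed.

Lemma smooth_on_comp_linear (R : realType) m n
    (f : {linear 'rV[R]_m.+1 -> 'rV[R]_n.+1}) (sg : 'I_m.+1 -> 'I_n.+1)
    (A : set 'rV[R]_n.+1) (g : 'rV[R]_n.+1 -> R) :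
  (forall i, f (delta_mx 0 i) = delta_mx 0 (sg i)) ->
  smooth_on A g -> smooth_on (f @^-1` A) (g \o f).
Proof.
move=> fE sA s p Ap; rewrite (foldr_partial_comp_linear _ _ fE).
have [gc gd] := sA (map sg s) _ Ap; split=> [|i].
  by apply: continuous_comp => //; exact: linear_rV_continuous.
rewrite (@derivable_comp_affine _ _ _ _ _ _ _ _ (delta_mx 0 (sg i))) => // h.
by rewrite linearP -fE.
Qed.

(** * The coordinate projections and the slice t = 0 *)

Lemma sum3E (R : realType) (F : 'I_3 -> R) : \sum_i F i = F 0 + F 1 + F 2.
Proof.
rewrite !big_ord_recl big_ord0 addr0 addrA.
by congr (F _ + F _ + F _); apply/val_inj.
Qed.

Lemma sum5E (R : realType) (F : 'I_5 -> R) :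
  \sum_i F i = F 0 + F 1 + F 2 + F 3 + F 4.
Proof.
rewrite !big_ord_recl big_ord0 addr0 !addrA.
by congr (F _ + F _ + F _ + F _ + F _); apply/val_inj.
Qed.

Lemma ord3_ind (P : 'I_3 -> Prop) : P 0 -> P 1 -> P 2 -> forall i, P i.
Proof.
move=> P0 P1 P2 [[|[|[|?]]] ilt] //;
  [move: P0|move: P1|move: P2]; congr (P _); exact/val_inj.
Qed.

Lemma ord5_ind (P : 'I_5 -> Prop) :
  P 0 -> P 1 -> P 2 -> P 3 -> P 4 -> forall i, P i.
Proof.
move=> P0 P1 P2 P3 P4 [[|[|[|[|[|?]]]]] ilt] //;
  [move: P0|move: P1|move: P2|move: P3|move: P4];
  congr (P _); exact/val_inj.
Qed.

(** The section t = 0 of [proj32]. *)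
Definition slice {R : realType} (x : 'rV[R]_2) : 'rV[R]_3 :=
  rowv [:: 0; x 0 0; x 0 1].

Fact proj32_linear (R : realType) : linear (@proj32 R).
Proof.
by move=> a x y; apply/rowP; case=> [[|[|?]] ?] //; rewrite !mxE /= ?mxE.
Qed.
HB.instance Definition _ (R : realType) :=
  GRing.isLinear.Build R 'rV[R]_3 'rV[R]_2 _ (@proj32 R) (@proj32_linear R).

Fact proj53_linear (R : realType) : linear (@proj53 R).
Proof.
by move=> a x y; apply/rowP; case=> [[|[|[|?]]] ?] //; rewrite !mxE /= ?mxE.
Qed.
HB.instance Definition _ (R : realType) :=
  GRing.isLinear.Build R 'rV[R]_5 'rV[R]_3 _ (@proj53 R) (@proj53_linear R).

Fact projJ3_linear (R : realType) : linear (@projJ3 R).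
Proof.
by move=> a x y; apply/rowP; case=> [[|[|?]] ?] //; rewrite !mxE /= ?mxE.
Qed.
HB.instance Definition _ (R : realType) :=
  GRing.isLinear.Build R 'rV[R]_3 'rV[R]_2 _ (@projJ3 R) (@projJ3_linear R).

Fact slice_linear (R : realType) : linear (@slice R).
Proof.
move=> a x y; apply/rowP; case=> [[|[|[|?]]] ?] //; rewrite !mxE /= ?mxE //.
by rewrite mulr0 addr0.
Qed.
HB.instance Definition _ (R : realType) :=
  GRing.isLinear.Build R 'rV[R]_2 'rV[R]_3 _ (@slice R) (@slice_linear R).

Lemma sliceK (R : realType) : cancel (@slice R) proj32.
Proof.
move=> x; apply/rowP; case=> [[|[|?]] ?] //; rewrite !mxE /=;
  by congr (x _ _); apply/val_inj.
Qed.

Lemma slice_delta (R : realType) (i : 'I_2) :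
  slice (delta_mx 0 i) = delta_mx 0 (lift 0 i) :> 'rV[R]_3.
Proof.
by apply/rowP; case: i => [[|[|?]] ?] //; case=> [[|[|[|?]]] ?] //;
  rewrite !mxE /= ?mxE.
Qed.

Lemma slice_proj32 (R : realType) (p : 'rV[R]_3) :
  p = p 0 0 *: delta_mx 0 0 + slice (proj32 p).
Proof.
by apply/rowP; case=> [[|[|[|?]]] ?] //; rewrite !mxE /= ?mxE /=
  ?mulr0 ?mulr1 ?addr0 ?add0r; congr (p _ _); apply/val_inj.
Qed.

Lemma proj32_delta0 (R : realType) : proj32 (delta_mx 0 0) = 0 :> 'rV[R]_2.
Proof. by apply/rowP; case=> [[|[|?]] ?] //; rewrite !mxE /= ?mxE. Qed.

Lemma proj32_proj53_delta (R : realType) :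
  [/\ proj32 (proj53 (delta_mx 0 0)) = 0 :> 'rV[R]_2,
      proj32 (proj53 (delta_mx 0 1)) = delta_mx 0 0 :> 'rV[R]_2,
      proj32 (proj53 (delta_mx 0 2)) = delta_mx 0 1 :> 'rV[R]_2,
      proj32 (proj53 (delta_mx 0 3)) = 0 :> 'rV[R]_2 &
      proj32 (proj53 (delta_mx 0 4)) = 0 :> 'rV[R]_2].
Proof.
by split; apply/rowP; case=> [[|[|?]] ?] //; rewrite !mxE /= ?mxE.
Qed.

Lemma projJ3_delta (R : realType) :
  [/\ projJ3 (delta_mx 0 0) = delta_mx 0 0 :> 'rV[R]_2,
      projJ3 (delta_mx 0 1) = delta_mx 0 1 :> 'rV[R]_2 &
      projJ3 (delta_mx 0 2) = 0 :> 'rV[R]_2].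
Proof.
by split; apply/rowP; case=> [[|[|?]] ?] //; rewrite !mxE /= ?mxE.
Qed.

(** * The push-forward of a field with time-independent components *)

Lemma is_pushforward_proj32P (R : realType) (U : set 'rV[R]_2) X Y :
  is_pushforward (M3 U) proj32 X Y <->
  forall p, M3 U p -> Y (proj32 p) = proj32 (X p).
Proof.
have dE p v : 'd proj32 p v = proj32 v :> 'rV[R]_2.
  by rewrite diff_lin //; exact: linear_rV_continuous.
by split=> XY p Up; move: (XY p Up); rewrite dE.
Qed.

(** The time line through [p] stays in [M3 U] for all real times, so the mean
    value theorem applies on all of it. *)
Lemma constant_along_time (R : realType) (U : set 'rV[R]_2)
    (g : 'rV[R]_3 -> R) :
  smooth_on (M3 U) g -> (forall p, M3 U p -> partial 0 g p = 0) ->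
  forall p, M3 U p -> g p = g (slice (proj32 p)).
Proof.
move=> sg g0 p Up; rewrite {1}(slice_proj32 p).
apply: eq_along_direction => h; set q := _ + _.
have Uq : M3 U q.
  by rewrite /M3 /= /q linearP /= proj32_delta0 scaler0 add0r sliceK.
by have [_ gd] := sg [::] q Uq; split; [exact: gd|exact: g0].
Qed.

(** * Prolonged fields acting on the equations *)

Lemma partial_coord_sub (R : realType) m n (j i : 'I_m.+1)
    (f : {linear 'rV[R]_m.+1 -> 'rV[R]_n.+1}) (w : 'rV[R]_n.+1 -> R) q :
  derivable w (f q) (f (delta_mx 0 i)) ->
  partial i (fun q : 'rV[R]_m.+1 => q 0 j - w (f q)) q =
    (j == i)%:R - 'D_(f (delta_mx 0 i)) w (f q).
Proof.
move=> dw; have [cd cE] := derivable_coord j q (delta_mx 0 i).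
have fE (h : R) : f (h *: delta_mx 0 i + q) = h *: f (delta_mx 0 i) + f q.
  by rewrite linearP.
rewrite /partial -[fun q => _]/((fun q : 'rV[R]_m.+1 => q 0 j) - (w \o f)).
rewrite deriveB ?(derivable_comp_affine _ fE) //.
by rewrite (derive_comp_affine _ fE) cE mxE /=.
Qed.

(** The equations of both jet spaces have the form q_j = w(f q) with [f] linear,
    which covers du/dt = omega_u, dv/dt = omega_v and v' = Omega at once. *)
Lemma field_act_coord_sub (R : realType) m n (j : 'I_m.+1)
    (f : {linear 'rV[R]_m.+1 -> 'rV[R]_n.+1}) (w : 'rV[R]_n.+1 -> R)
    (Z : 'rV[R]_m.+1 -> 'rV[R]_m.+1) q :
  (forall i, derivable w (f q) (f (delta_mx 0 i))) ->
  field_act Z (fun q : 'rV[R]_m.+1 => q 0 j - w (f q)) q =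
    Z q 0 j - \sum_i Z q 0 i * 'D_(f (delta_mx 0 i)) w (f q).
Proof.
move=> dw; rewrite /field_act.
under eq_bigr => i _ do rewrite (partial_coord_sub _ (dw i)) mulrBr.
rewrite sumrB; congr (_ - _); rewrite (bigD1 j) //= eqxx mulr1 big1 ?addr0 //.
by move=> i ij; rewrite eq_sym (negbTE ij) mulr0.
Qed.

Lemma field_act_time (R : realType) (w : 'rV[R]_2 -> R) (j : 'I_5)
    (Z : 'rV[R]_5 -> 'rV[R]_5) q (x := proj32 (proj53 q)) :
  (forall i, derivable w x (delta_mx 0 i)) ->
  field_act Z (fun q => q 0 j - w (proj32 (proj53 q))) q =
    Z q 0 j - (Z q 0 1 * partial 0 w x + Z q 0 2 * partial 1 w x).
Proof.
move=> dw; have [e0 e1 e2 e3 e4] := proj32_proj53_delta R.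
rewrite (@field_act_coord_sub _ _ _ j (proj32 \o proj53) w).
  by rewrite sum5E /= e0 e1 e2 e3 e4 !derive0 !mulr0 add0r !addr0.
by apply: ord5_ind => /=; rewrite ?(e0, e1, e2, e3, e4) //; exact: derivable0.
Qed.

Lemma field_act_phase (R : realType) (w : 'rV[R]_2 -> R) (j : 'I_3)
    (Z : 'rV[R]_3 -> 'rV[R]_3) q (x := projJ3 q) :
  (forall i, derivable w x (delta_mx 0 i)) ->
  field_act Z (fun q => q 0 j - w (projJ3 q)) q =
    Z q 0 j - (Z q 0 0 * partial 0 w x + Z q 0 1 * partial 1 w x).
Proof.
move=> dw; have [e0 e1 e2] := projJ3_delta R.
rewrite (@field_act_coord_sub _ _ _ j (@projJ3 R) w).
  by rewrite sum3E /= e0 e1 e2 !derive0 !mulr0 addr0.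
by apply: ord3_ind => /=; rewrite ?(e0, e1, e2) //; exact: derivable0.
Qed.

(** The derivative is grouped with a single overall denominator to match
    eta(omega_v) - Omega * eta(omega_u) = omega_u * eta(Omega). *)
Lemma partial_quotient (R : realType) n (a b : 'rV[R]_n.+1 -> R) x i :
  b x != 0 -> derivable a x (delta_mx 0 i) -> derivable b x (delta_mx 0 i) ->
  derivable (fun y => a y / b y) x (delta_mx 0 i) /\
  partial i (fun y => a y / b y) x =
    (partial i a x - a x / b x * partial i b x) / b x.
Proof.
move=> b0 da db; have dV := derivableV b0 db.
split; first exact: derivableM.
rewrite /partial -[fun y => _]/(a * (fun y => (b y)^-1)) deriveM // deriveV //.
by rewrite /GRing.scale /=; field.
Qed.

Theorem theorem2 (R : realType) (U : set 'rV[R]_2)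
    (omega_u omega_v : 'rV[R]_2 -> R) (X : 'rV[R]_3 -> 'rV[R]_3)
    (openU : open U)
    (smooth_omega_u : smooth_on U omega_u)
    (smooth_omega_v : smooth_on U omega_v)
    (omega_u_neq0 : forall p, U p -> omega_u p <> 0)
    (smoothX : smooth_field (M3 U) X)
    (eta_u_t : forall p, M3 U p -> partial 0 (fun p => X p 0 1) p = 0)
    (eta_v_t : forall p, M3 U p -> partial 0 (fun p => X p 0 2) p = 0)
    (symX : time_symmetry U omega_u omega_v X) :
  (exists Y : 'rV[R]_2 -> 'rV[R]_2, is_pushforward (M3 U) proj32 X Y) /\
  (forall Y : 'rV[R]_2 -> 'rV[R]_2, is_pushforward (M3 U) proj32 X Y ->
    [/\ smooth_field U Y,
        (forall p, M3 U p -> Y (proj32 p) = rowv [:: X p 0 1; X p 0 2])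
      & phase_symmetry U (fun p => omega_v p / omega_u p) Y]).
Proof.
have M3slice x : U x -> M3 U (slice x) by rewrite /M3 /= sliceK.
split.
  exists (fun x => proj32 (X (slice x))); apply/is_pushforward_proj32P => p Up.
  have uE := constant_along_time (smoothX 1) eta_u_t Up.
  have vE := constant_along_time (smoothX 2) eta_v_t Up.
  by apply/rowP; case=> [[|[|?]] ?] //; rewrite !mxE /= ?uE ?vE.
move=> Y /is_pushforward_proj32P XY.
(* [lift 0] turns the indices of (u, v) into those of (t, u, v). *)
have YE (i : 'I_2) x : U x -> X (slice x) 0 (lift 0 i) = Y x 0 i.
  move=> Ux; rewrite -[x in RHS]sliceK XY ?mxE; last exact: M3slice.
  by case: i => [[|[|?]] ?] //=; congr (X _ _ _); apply/val_inj.
have partialYE (i k : 'I_2) x : U x ->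
    partial k (fun y => Y y 0 i) x =
    partial (lift 0 k) (fun p => X p 0 (lift 0 i)) (slice x).
  move=> Ux; have /= <- := partial_eq_on [:: k] openU (YE i) Ux.
  have /= -> := partial_comp_linear slice (fun p => X p 0 (lift 0 i)) k x.
  by rewrite slice_delta.
split=> [i|p Up|q [Uq qE]]; [|exact: XY|].
  apply: (smooth_on_eq openU (YE i)).
  have := smooth_on_comp_linear (@slice_delta R) (smoothX (lift 0 i)).
  by rewrite [slice @^-1` _](_ : _ = U) //; apply/funext => x;
    rewrite /M3 /= /preimage /= sliceK.
set x := projJ3 q in Uq qE *.
have du i : derivable omega_u x (delta_mx 0 i).
  by have [_] := smooth_omega_u [::] x Uq.
have dv i : derivable omega_v x (delta_mx 0 i).
  by have [_] := smooth_omega_v [::] x Uq.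
have u0 : omega_u x != 0 by apply/eqP/omega_u_neq0.
have [_ O0] := partial_quotient u0 (dv 0) (du 0).
have [_ O1] := partial_quotient u0 (dv 1) (du 1).
rewrite (@field_act_phase _ (fun y => omega_v y / omega_u y)); last first.
  by move=> i; have [] := partial_quotient u0 (dv i) (du i).
(* The point of the system over t = 0 and x at which its symmetry is used. *)
pose r : 'rV[R]_5 := rowv [:: 0; x 0 0; x 0 1; omega_u x; omega_v x].
have rE : proj53 r = slice x.
  by apply/rowP; apply: ord3_ind; rewrite !mxE /= ?mxE.
have Dr : Delta U omega_u omega_v r.
  by split; rewrite rE ?sliceK ?mxE //; exact: M3slice.
have l0 : lift 0 (0 : 'I_2) = 1 :> 'I_3 by apply/val_inj.
have l1 : lift 0 (1 : 'I_2) = 2 :> 'I_3 by apply/val_inj.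
have [] := symX _ Dr.
rewrite !field_act_time ?rE ?sliceK // !mxE /= /Dt /Du rE -/x.
rewrite eta_u_t ?eta_v_t; try exact: M3slice.
rewrite O0 O1 !partialYE // -!YE // !l0 !l1 !mxE /= qE !add0r.
(* Multiplied by omega_u, the phase-plane condition is the second
   time-domain condition minus Omega times the first one. *)
have eliminate (Eu Ev P : R) :
    P * omega_u x = Ev - omega_v x / omega_u x * Eu ->
    Eu = 0 -> Ev = 0 -> P = 0.
  move=> PE Eu0 Ev0; apply: (mulIf u0).
  by rewrite PE Eu0 Ev0 mulr0 subr0 mul0r.
by apply: eliminate; field.
Qed.
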